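(* Let $t > 2$ and $1 \leq k_1 \leq \cdots \leq k_t$ be integers with $n = k_1 + \cdots + k_t \geq 4$, let $K_{k_1,\ldots,k_t}$ have vertex set $[n]$, and let $X$ be a tree on $n$ vertices. If $X$ does not contain an $(n-k_t)$-bridge, then for any $i, j \in [n]$ and any bijection $\sigma: V(X) \to [n]$ with $\{\sigma^{-1}(i), \sigma^{-1}(j)\} \in E(X)$, the vertices $i$ and $j$ are $(X, K_{k_1,\ldots,k_t})$-exchangeable from $\sigma$.
   Context: All graphs are simple. For graphs $X, Y$ on $n$ vertices, the friends-and-strangers graph $\mathsf{FS}(X,Y)$ has as vertices all bijections $\sigma: V(X) \to V(Y)$; two bijections $\sigma, \sigma'$ are adjacent iff there is an edge $\{a,b\} \in E(X)$ with $\{\sigma(a),\sigma(b)\} \in E(Y)$, $\sigma'(a) = \sigma(b)$, $\sigma'(b) = \sigma(a)$, and $\sigma'(c) = \sigma(c)$ for all other $c$ (an $(X,Y)$-friendly swap). For a bijection $\sigma$ and $u, v \in V(Y)$, $u$ and $v$ are $(X,Y)$-exchangeable from $\sigma$ if some sequence of $(X,Y)$-friendly swaps takes $\sigma$ to $(u\; v)\circ\sigma$. $K_{k_1,\ldots,k_t}$ is the complete $t$-partite graph with classes of sizes $k_1,\ldots,k_t$. A path $v_1, \ldots, v_k$ in a graph is a $k$-bridge if each edge of the path is a cut-edge, $v_2,\ldots,v_{k-1}$ have degree $2$, and $v_1, v_k$ do not have degree $1$; a single cut-vertex is a $1$-bridge. *)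

(* Defs.v *)
From HB Require Import structures.
From mathcomp Require Import all_boot perm.

Set Implicit Arguments.
Unset Strict Implicit.
Unset Printing Implicit Defensive.

Record sgraph (V : finType) := SGraph {
  adj :> rel V;
  adj_sym : symmetric adj;
  adj_irr : irreflexive adj
}.

Section GraphNotions.
Variables (V : finType) (X : sgraph V).

Definition degree (v : V) : nat := #|[set w | X v w]|.

Definition is_tree : Prop :=
  [/\ 0 < #|V|,
      forall x y : V, connect X x y
    & forall c : seq V, 2 < size c -> ~ ucycle X c].

Definition n_components : nat := n_comp X predT.

Definition del_edge_rel (u v : V) : rel V :=
  [rel x y | X x y && ([set x; y] != [set u; v])].

Lemma del_edge_sym u v : symmetric (del_edge_rel u v).
Proof. by move=> x y; rewrite /del_edge_rel /= (adj_sym X) setUC. Qed.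

Lemma del_edge_irr u v : irreflexive (del_edge_rel u v).
Proof. by move=> x; rewrite /del_edge_rel /= (adj_irr X). Qed.

Definition del_edge u v : sgraph V :=
  SGraph (del_edge_sym u v) (del_edge_irr u v).

Definition del_vertex_rel (v : V) : rel {x : V | x != v} :=
  [rel x y | X (val x) (val y)].

Lemma del_vertex_sym v : symmetric (@del_vertex_rel v).
Proof. by move=> x y; rewrite /del_vertex_rel /= (adj_sym X). Qed.

Lemma del_vertex_irr v : irreflexive (@del_vertex_rel v).
Proof. by move=> x; rewrite /del_vertex_rel /= (adj_irr X). Qed.

Definition del_vertex (v : V) : sgraph {x : V | x != v} :=
  SGraph (@del_vertex_sym v) (@del_vertex_irr v).

End GraphNotions.

Section Bridges.
Variables (V : finType) (X : sgraph V).

Definition cut_edge : rel V :=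
  [rel u v | X u v && (n_components X < n_components (del_edge X u v))].

Definition cut_vertex : pred V :=
  [pred v | n_components X < n_components (del_vertex X v)].

(* In the last case [behead (belast v q)] lists the interior vertices of the
   path [v :: q]. *)
Definition is_bridge (p : seq V) : bool :=
  match p with
  | [::] => false
  | [:: v] => cut_vertex v
  | v :: q =>
      [&& path cut_edge v q, uniq (v :: q),
          all (fun w => degree X w == 2) (behead (belast v q)),
          degree X v != 1 & degree X (last v q) != 1]
  end.

Definition contains_bridge (k : nat) : Prop :=
  exists2 p : seq V, size p = k & is_bridge p.

End Bridges.

Definition is_complete_multipartite (V : finType) (t : nat) (k : t.-tuple nat)
    (Y : sgraph V) : Prop :=
  exists2 part : V -> 'I_t,
    forall c : 'I_t, #|[set v | part v == c]| = tnth k c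
  & forall u v : V, Y u v = (part u != part v).

Record bij (V W : finType) := Bij {
  bij_fun :> {ffun V -> W};
  bijP : injectiveb bij_fun && [forall w, w \in codom bij_fun]
}.

HB.instance Definition _ (V W : finType) := [isSub for @bij_fun V W].
HB.instance Definition _ (V W : finType) := [Finite of bij V W by <:].

Section Bijections.
Variables (V W : finType).
Implicit Types (s : bij V W).

Lemma bij_inj s : injective s.
Proof. by have /andP[/injectiveP] := bijP s. Qed.

Lemma bij_surj s w : w \in codom s.
Proof. by have /andP[_ /forallP] := bijP s. Qed.

Definition bij_inv s (w : W) : V := iinv (bij_surj s w).

Lemma bij_invK s : cancel (bij_inv s) s.
Proof. by move=> w; rewrite /bij_inv f_iinv. Qed.

Lemma bijK s : cancel s (bij_inv s).
Proof. by move=> v; apply: (@bij_inj s); rewrite bij_invK. Qed.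

Lemma bij_tperm_subproof s (u v : W) :
  let f := [ffun x => tperm u v (s x)] in
  injectiveb f && [forall w, w \in codom f].
Proof.
apply/andP; split.
  by apply/injectiveP => x y; rewrite !ffunE => /perm_inj /bij_inj.
apply/forallP => w; apply/codomP; exists (bij_inv s (tperm u v w)).
by rewrite ffunE bij_invK tpermK.
Qed.

Definition bij_tperm s (u v : W) : bij V W := Bij (bij_tperm_subproof s u v).

End Bijections.

Section FriendsAndStrangers.
Variables (V W : finType) (X : sgraph V) (Y : sgraph W).

Definition friendly_swap : rel (bij V W) :=
  [rel s s' : bij V W | [exists a, exists b,
    [&& X a b, Y (s a) (s b), s' a == s b, s' b == s a
      & [forall c, (c != a) && (c != b) ==> (s' c == s c)]]]].

Lemma friendly_swap_sym : symmetric friendly_swap.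
Proof.
suff imp s s' : friendly_swap s s' -> friendly_swap s' s.
  by move=> s s'; apply/idP/idP; apply: imp.
move=> /existsP[a /existsP[b /and5P[Xab Yab /eqP ea /eqP eb /forallP ec]]].
apply/existsP; exists a; apply/existsP; exists b.
rewrite Xab ea eb !eqxx (adj_sym Y) Yab /=.
by apply/forallP => c; rewrite (eq_sym (s c)); apply: ec.
Qed.

Lemma friendly_swap_irr : irreflexive friendly_swap.
Proof.
move=> s; apply/negbTE/negP => /existsP[a /existsP[b /and5P[_ Yab /eqP ea _ _]]].
by rewrite ea (adj_irr Y) in Yab.
Qed.

Definition FS : sgraph (bij V W) :=
  SGraph friendly_swap_sym friendly_swap_irr.

Definition exchangeable (s : bij V W) (u v : W) : Prop :=
  connect FS s (bij_tperm s u v).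

End FriendsAndStrangers.

(* Main.v *)
(* Call two persons exchangeable from a state when their transposition is
   reachable.  For persons of one part this only depends on the component of
   the state, because such a transposition is an automorphism of the
   multipartite graph; so the two persons may first be moved anywhere.

   Let c be the part of the two adjacent persons, and call everybody outside c
   a hole.  Next to a branching vertex, two persons of c and two holes of
   different parts can be exchanged inside a star K_{1,3}; if both holes have
   the same part, a person of a third part, which exists since t > 2, can be
   walked to the star.  If the two persons stand at p and q and are not
   exchangeable, then every branching vertex on the far side of q is too far
   away for the holes on that side to let the pair reach it with two holes to
   spare.  So that side starts with a bare path having as many vertices as the
   side has holes, and likewise at p.  Joined along pq, these two paths form a
   bridge with as many vertices as there are holes, which is at least
   n - k_t. *)

Require Import Defs.
From mathcomp Require Import all_boot perm.
From mathcomp Require Import zify.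

Set Implicit Arguments.
Unset Strict Implicit.
Unset Printing Implicit Defensive.

(** * Branches of a tree at a vertex *)

Section Trees.
Variables (V : finType) (X : sgraph V).
Hypothesis treeX : is_tree X.

Lemma tree_del_edge_disconnects a b : X a b -> ~~ connect (del_edge X a b) b a.
Proof.
case: treeX => _ _ acycX Xab; apply/negP => /connectP[p0 path0 last0].
case: (shortenP path0) last0 => p pathp uniqp _ lastp {p0 path0}.
have sub : subrel (del_edge X a b) X by move=> x y /andP[].
have nab : a != b by apply: contraTneq Xab => ->; rewrite adj_irr.
(* A simple path from [b] to [a] avoiding the edge closes up with it to a cycle. The cycle has more
   than two vertices: [p] is nonempty as [a != b], and a path of one edge would be the deleted edge
   itself. *)
apply: (acycX (b :: p)).
  case: p lastp pathp {uniqp} => [/= eab|x [|//]] /=; first by rewrite eab eqxx in nab.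
  by move=> -> /andP[/andP[_]]; rewrite setUC eqxx.
rewrite /ucycle uniqp /cycle rcons_path (sub_path sub pathp) -lastp.
by rewrite Xab.
Qed.

Lemma tree_cut_edge a b : X a b -> cut_edge X a b.
Proof.
move=> Xab; rewrite /cut_edge /= Xab /=.
case: (treeX) => _ connX _.
have symX : connect_sym X by apply: sym_connect_sym; apply: adj_sym.
have symD : connect_sym (del_edge X a b) by apply: sym_connect_sym; apply: adj_sym.
have -> : n_components X = 1.
  rewrite -(n_comp_connect symX a) /n_components; apply: eq_n_comp_r => x.
  by rewrite !inE connX.
apply/card_gt1P; exists (root (del_edge X a b) a), (root (del_edge X a b) b).
rewrite !inE !roots_root // root_connect // symD.
by split=> //; exact: tree_del_edge_disconnects.
Qed.

(** Isolates [v] instead of passing to a subtype, so that branches are sets of vertices of the whole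
    tree. For [x] adjacent to [v], [branch v x] is the component of [x] once [v] is removed. *)
Definition del_rel v : rel V := [rel a b | [&& X a b, a != v & b != v]].

Definition branch v x : {set V} := [set z | connect (del_rel v) x z].

Lemma del_rel_sym v : connect_sym (del_rel v).
Proof.
by apply: sym_connect_sym => x y; rewrite /del_rel /= (adj_sym X) [(x != v) && _]andbC.
Qed.

Lemma branch_root v x : x \in branch v x.
Proof. by rewrite inE connect0. Qed.

Lemma branch_neq v x z : X v x -> z \in branch v x -> z != v.
Proof.
move=> Xvx; rewrite inE => /connectP[p]; case/lastP: p => [_ -> /=|p y].
  by apply: contraTneq Xvx => ->; rewrite adj_irr.
by rewrite rcons_path last_rcons => /andP[_ /and3P[_ _ ?]] ->.
Qed.

Lemma branch_cover v z : z != v -> exists2 x, X v x & z \in branch v x.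
Proof.
case: treeX => _ /(_ v z)/connectP[p0 path0 last0] _ nzv.
case: (shortenP path0) last0 => [[|x p]] pathp uniqp _ lastp {p0 path0}.
  by rewrite lastp eqxx in nzv.
move: pathp uniqp => /= /andP[Xvx pathp] /and3P[nv _ _]; exists x => //.
rewrite inE; apply/connectP; exists p => //.
elim: p x nv pathp {Xvx lastp} => //= y p IHp x; rewrite !inE !negb_or.
case/and3P=> nvx nvy nvp /andP[Xxy pathp].
by rewrite /del_rel /= Xxy IHp ?inE ?negb_or ?nvy // eq_sym nvx eq_sym nvy.
Qed.

(** A common vertex would give a walk from [b] to [v] whose first half avoids [v] and whose second
    half avoids [b]; neither half could use the edge [vb]. *)
Lemma branch_opp v b z : X v b -> z \in branch v b -> z \in branch b v -> False.
Proof.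
move=> Xvb; rewrite !inE => cbz cvz.
have /negP := tree_del_edge_disconnects Xvb; apply.
have subv : subrel (del_rel v) (connect (del_edge X v b)).
  move=> x y /and3P[Xxy nx ny]; apply: connect1; rewrite /= /del_edge_rel /= Xxy /=.
  apply/eqP => /setP/(_ v); rewrite !inE eqxx /=.
  by rewrite !(eq_sym v) (negbTE nx) (negbTE ny).
have subb : subrel (del_rel b) (connect (del_edge X v b)).
  move=> x y /and3P[Xxy nx ny]; apply: connect1; rewrite /= /del_edge_rel /= Xxy /=.
  apply/eqP => /setP/(_ b); rewrite !inE eqxx orbT /=.
  by rewrite !(eq_sym b) (negbTE nx) (negbTE ny).
apply: connect_trans (connect_sub subv cbz) _.
by apply: (connect_sub subb); rewrite del_rel_sym.
Qed.

(** Otherwise a walk from [x] to [y] off [v], followed by the edge [yv], would join [x] to [v]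
    without the edge [vx]. *)
Lemma branch_uniq v x y z :
  X v x -> X v y -> z \in branch v x -> z \in branch v y -> x = y.
Proof.
move=> Xvx Xvy zx zy; apply/eqP; apply/negPn/negP => nxy.
have nyv : y != v by apply: branch_neq (branch_root _ _).
have /negP := tree_del_edge_disconnects Xvx; apply.
have subv : subrel (del_rel v) (connect (del_edge X v x)).
  move=> a b /and3P[Xab na nb]; apply: connect1; rewrite /= /del_edge_rel /= Xab /=.
  apply/eqP => /setP/(_ v); rewrite !inE eqxx /=.
  by rewrite !(eq_sym v) (negbTE na) (negbTE nb).
have cxy : connect (del_rel v) x y.
  by move: zx zy; rewrite !inE [connect _ y z]del_rel_sym; apply: connect_trans.
apply: connect_trans (connect_sub subv cxy) (connect1 _).
rewrite /= /del_edge_rel /= (adj_sym X) Xvy /=; apply/eqP => /setP/(_ y).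
by rewrite !inE eqxx (negbTE nyv) eq_sym (negbTE nxy).
Qed.

(** At [b], the vertex [v] lies in a branch other than that of [z1]. So a walk from [z1] off [b]
    also stays off [v], and the edge from [b] to [z1] can be put in front of it. *)
Lemma branch_sub v b z1 :
  X v b -> X b z1 -> z1 != v -> {subset branch b z1 <= branch v b}.
Proof.
move=> Xvb Xbz nz z zb.
have Xbv : X b v by rewrite (adj_sym X).
have nv : forall y, connect (del_rel b) z1 y -> y != v.
  move=> y cy; apply: contraNneq nz => eyv.
  apply/eqP; apply: (@branch_uniq b _ _ v) => //; last exact: branch_root.
  by rewrite inE -eyv.
rewrite inE; apply: (@connect_trans _ _ z1).
  apply: connect1; rewrite /del_rel /= Xbz nz andbT.
  by apply: contraTneq Xvb => ->; rewrite adj_irr.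
move: zb; rewrite inE => /connectP[p pathp ->]; apply/connectP; exists p => //.
elim: p z1 pathp nv {Xbz nz} => //= y p IHp x /andP[xy pathp] nv.
have cy : connect (del_rel b) x y by apply: connect1.
rewrite {1}/del_rel /= (nv x) ?connect0 // (nv y) //; case/and3P: xy => -> _ _ /=.
by apply: IHp => // w cw; apply: nv; apply: connect_trans cw.
Qed.

Lemma branch_step v b z :
  X v b -> z \in branch v b -> z != b ->
  exists z1, [/\ X b z1, z1 != v & z \in branch b z1].
Proof.
move=> Xvb zb /branch_cover[z1 Xbz1 zz1]; exists z1; split=> //.
by apply/eqP => ez; rewrite ez in zz1; apply: branch_opp Xvb zb zz1.
Qed.

Lemma branch_total p q z : X p q -> (z \in branch p q) || (z \in branch q p).
Proof.
move=> Xpq; have Xqp : X q p by rewrite (adj_sym X).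
have [->|nzp] := eqVneq z p; first by rewrite branch_root orbT.
have [x Xpx zx] := branch_cover nzp.
have [<-|nxq] := eqVneq x q; first by rewrite zx.
by apply/orP; right; apply: branch_sub zx.
Qed.

Lemma branch_notin v x y z :
  X v x -> X v y -> x != y -> z \in branch v x -> z \notin branch v y.
Proof.
by move=> Xvx Xvy /eqP nxy zx; apply/negP => zy; apply: nxy; apply: branch_uniq zx zy.
Qed.

End Trees.

(** * Swaps along edges and exchangeability *)

Section Swaps.
Variables (V W : finType) (X : sgraph V) (Y : sgraph W).
Implicit Types (s : bij V W) (a b x : V) (u w : W).

Lemma bij_ext s s' : s =1 s' -> s = s'.
Proof. by move=> ess'; apply/val_inj/ffunP. Qed.

Lemma bij_tpermE s u w x : bij_tperm s u w x = tperm u w (s x).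
Proof. by rewrite ffunE. Qed.

(** Phrased through persons, so that the state required for exchanging [s a] and [s b] is
    [swap s a b] itself, whether or not [a] and [b] are adjacent. *)
Definition swap s a b : bij V W := bij_tperm s (s a) (s b).

Lemma swapE s a b x : swap s a b x = s (tperm a b x).
Proof. by rewrite bij_tpermE (inj_tperm _ _ _ (@Defs.bij_inj _ _ s)). Qed.

Lemma swapL s a b : swap s a b a = s b.
Proof. by rewrite swapE tpermL. Qed.

Lemma swapR s a b : swap s a b b = s a.
Proof. by rewrite swapE tpermR. Qed.

Lemma swapD s a b x : x != a -> x != b -> swap s a b x = s x.
Proof. by move=> nxa nxb; rewrite swapE tpermD // eq_sym. Qed.

Lemma connect_swap s a b :
  X a b -> Y (s a) (s b) -> connect (FS X Y) s (swap s a b).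
Proof.
move=> Xab Yab; apply: connect1; apply/existsP; exists a; apply/existsP; exists b.
rewrite Xab Yab swapL swapR !eqxx /=; apply/forallP => x; apply/implyP => /andP[xa xb].
by rewrite swapD.
Qed.

Lemma FS_connect_sym : connect_sym (FS X Y).
Proof. by apply: sym_connect_sym; apply: adj_sym. Qed.

(** An automorphism of [Y] turns friendly swaps into friendly swaps along the same edges of [X]. *)
Lemma connect_bij_tperm u w :
  (forall y z, Y (tperm u w y) (tperm u w z) = Y y z) ->
  forall s s', connect (FS X Y) s s' ->
  connect (FS X Y) (bij_tperm s u w) (bij_tperm s' u w).
Proof.
move=> autY s s' /connectP[p pathp ->] {s'}.
elim: p s pathp => [|s' p IHp] s /=; first by rewrite connect0.
case/andP=> /existsP[a /existsP[b /and5P[Xab Yab /eqP s'a /eqP s'b /forallP s'c]]].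
move=> /IHp; apply: connect_trans; apply: connect1.
apply/existsP; exists a; apply/existsP; exists b.
rewrite !bij_tpermE Xab autY Yab s'a s'b !eqxx /=.
apply/forallP => c; rewrite !bij_tpermE; apply/implyP => nc.
by have := s'c c; rewrite nc => /eqP->.
Qed.

Lemma exchangeable_sym s u w : exchangeable X Y s u w -> exchangeable X Y s w u.
Proof.
rewrite /exchangeable; have -> // : bij_tperm s w u = bij_tperm s u w.
by apply: bij_ext => x; rewrite !bij_tpermE tpermC.
Qed.

End Swaps.

(** * Exchanges in a complete multipartite graph *)

Section Multipartite.
Variables (V W : finType) (X : sgraph V) (Y : sgraph W).
Variables (P : eqType) (part : W -> P).
Hypothesis adjY : forall u w, Y u w = (part u != part w).
Implicit Types (s : bij V W) (a b v x y : V) (u w : W) (D : {set V}).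

Local Notation reach := (connect (FS X Y)).
Local Notation exch := (exchangeable X Y).

Lemma part_tperm u w z : part u = part w -> part (tperm u w z) = part z.
Proof. by move=> euw; case: tpermP => [->|->|]. Qed.

(** Walk to [s'], exchange there, and walk back along the image of the first walk under the
    transposition, which is an automorphism. *)
Lemma exchangeable_reach s s' u w :
  part u = part w -> reach s s' -> exch s' u w -> exch s u w.
Proof.
move=> euw ss' s'uw; apply: (connect_trans ss' (connect_trans s'uw _)).
rewrite FS_connect_sym; apply: connect_bij_tperm ss' => y z.
by rewrite !adjY !part_tperm.
Qed.

(** For distinct persons, [(u z) = (u w)(w z)(u w)], and each factor is realised by the image of a
    given walk under automorphisms. *)
Lemma exchangeable_trans s u w z :
  part u = part w -> part w = part z -> exch s u w -> exch s w z -> exch s u z.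
Proof.
move=> euw ewz suw swz.
have aut (u1 w1 : W) : part u1 = part w1 ->
    forall y z' : W, Y (tperm u1 w1 y) (tperm u1 w1 z') = Y y z'.
  by move=> e1 y z'; rewrite !adjY !part_tperm.
have [->|nuz] := eqVneq u z.
  rewrite /exchangeable; have -> : bij_tperm s z z = s; last exact: connect0.
  by apply: bij_ext => x; rewrite bij_tpermE tperm1 perm1.
have [->//|nuw] := eqVneq u w.
have [<-//|nwz] := eqVneq w z.
apply: (connect_trans suw).
apply: (connect_trans (connect_bij_tperm (aut _ _ euw) swz)).
have := connect_bij_tperm (aut _ _ euw) (connect_bij_tperm (aut _ _ ewz) suw).
congr (connect _ _ _); apply: bij_ext => x; rewrite !bij_tpermE.
rewrite (inj_tperm _ _ _ (@perm_inj _ (tperm u w))) tpermR tpermK.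
by rewrite (tpermD nuz nwz).
Qed.

(* Swapping [v] successively with [b], [d], [b], [c], [b], [d], [c] exchanges
   [b] and [c], without ever swapping [s b] with [s c]. *)
Lemma star_exchangeable s v b c d :
  X v b -> X v c -> X v d -> uniq [:: b; c; d] ->
  part (s b) = part (s c) -> part (s v) != part (s b) ->
  part (s d) != part (s b) -> part (s v) != part (s d) ->
  exch s (s b) (s c).
Proof.
move=> Xvb Xvc Xvd; rewrite /= !inE andbT negb_or.
move=> /andP[/andP[nbc nbd] ncd] ebc nvb ndb nvd.
have neq x : X v x -> v != x by apply: contraTneq => <-; rewrite adj_irr.
have [nb nc nd] := And3 (neq b Xvb) (neq c Xvc) (neq d Xvd).
have step s0 x : X v x -> part (s0 v) != part (s0 x) -> reach s0 (swap s0 v x).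
  by move=> Xvx n0; apply: connect_swap; rewrite ?adjY.
have evb s0 : [/\ swap s0 v b v = s0 b, swap s0 v b b = s0 v,
    swap s0 v b c = s0 c & swap s0 v b d = s0 d].
  by rewrite swapL swapR !swapD // eq_sym.
have evc s0 : [/\ swap s0 v c v = s0 c, swap s0 v c b = s0 b,
    swap s0 v c c = s0 v & swap s0 v c d = s0 d].
  by rewrite swapL swapR !swapD // eq_sym.
have evd s0 : [/\ swap s0 v d v = s0 d, swap s0 v d b = s0 b,
    swap s0 v d c = s0 c & swap s0 v d d = s0 v].
  by rewrite swapL swapR !swapD // eq_sym.
pose s1 := swap s v b; have [v1 b1 c1 d1] := evb s.
pose s2 := swap s1 v d; have [v2 b2 c2 d2] := evd s1.
pose s3 := swap s2 v b; have [v3 b3 c3 d3] := evb s2.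
pose s4 := swap s3 v c; have [v4 b4 c4 d4] := evc s3.
pose s5 := swap s4 v b; have [v5 b5 c5 d5] := evb s4.
pose s6 := swap s5 v d; have [v6 b6 c6 d6] := evd s5.
pose s7 := swap s6 v c; have [v7 b7 c7 d7] := evc s6.
rewrite -/s1 in v1 b1 c1 d1; rewrite -/s2 ?v1 ?b1 ?c1 ?d1 in v2 b2 c2 d2.
rewrite -/s3 ?v2 ?b2 ?c2 ?d2 in v3 b3 c3 d3; rewrite -/s4 ?v3 ?b3 ?c3 ?d3 in v4 b4 c4 d4.
rewrite -/s5 ?v4 ?b4 ?c4 ?d4 in v5 b5 c5 d5; rewrite -/s6 ?v5 ?b5 ?c5 ?d5 in v6 b6 c6 d6.
rewrite -/s7 ?v6 ?b6 ?c6 ?d6 in v7 b7 c7 d7.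
have ndv : part (s d) != part (s v) by rewrite eq_sym.
have nbd' : part (s b) != part (s d) by rewrite eq_sym.
have nbv' : part (s b) != part (s v) by rewrite eq_sym.
rewrite /exchangeable; have -> : bij_tperm s (s b) (s c) = s7.
  apply: bij_ext => x; rewrite -/(swap s b c).
  have [->|nxv] := eqVneq x v; first by rewrite swapD.
  have [->|nxb] := eqVneq x b; first by rewrite swapL.
  have [->|nxc] := eqVneq x c; first by rewrite swapR.
  rewrite swapD //; have [->//|nxd] := eqVneq x d.
  by rewrite /s7 /s6 /s5 /s4 /s3 /s2 /s1 !swapD.
(* The seven swaps are peeled off from the last one backwards. Only the three distinct parts of
   [s v], [s d] and [s b] meet, once [ebc] identifies the part of [s c] with that of [s b]. *)
do 6 (apply: connect_trans (step _ _ _ _); last 2 first;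
  [ by []
  | by rewrite ?(v1, b1, c1, d1, v2, b2, c2, d2, v3, b3, c3, d3, v4, b4, c4, d4,
                 v5, b5, c5, d5, v6, b6, c6, d6) -?ebc
  | ]).
by apply: step.
Qed.


Lemma exchangeable_moved s s' a b a' b' :
  part (s a) = part (s b) -> reach s s' -> s' a' = s a -> s' b' = s b ->
  exch s' (s' a') (s' b') -> exch s (s a) (s b).
Proof. by move=> eab ss' -> ->; apply: exchangeable_reach. Qed.

(* Two persons on different sides of [pr] can always swap, so the first person
   in [pr] on the way from [x] to [z] can walk to [x]. *)
Lemma bring (pr : pred W) s v x z :
  (forall u w, pr u -> ~~ pr w -> part u != part w) ->
  z \in branch X v x -> pr (s z) ->
  exists s', [/\ reach s s', pr (s' x)
    & forall y, y \notin branch X v x -> s' y = s y].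
Proof.
move=> prP; rewrite inE => /connectP[p pathp ->] {z}.
elim: p x pathp => [|y p IHp] x /=; first by move=> _ ?; exists s; rewrite connect0.
case/andP=> xy pathp /(IHp _ pathp)[s1 [ss1 s1y s1out]].
have s1out' z : z \notin branch X v x -> s1 z = s z.
  rewrite inE => nz; apply: s1out; rewrite inE; apply: contra nz.
  by apply: connect_trans; apply: connect1.
have [prx|nprx] := boolP (pr (s1 x)); first by exists s1.
exists (swap s1 x y); split; last 2 [by rewrite swapL].
- apply: (connect_trans ss1); apply: connect_swap; first by case/andP: xy.
  by rewrite adjY eq_sym prP.
move=> z nz; rewrite swapD ?s1out' //; first by apply: contraNneq nz => ->; apply: branch_root.
by apply: contraNneq nz => ->; rewrite inE connect1.
Qed.

(** * Holes and gadgets at branching vertices *)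

Section Exchange.
Hypothesis treeX : is_tree X.
Hypothesis third_part : forall d e : P, exists u, (part u != d) && (part u != e).
Variable c : P.

Definition nholes s (D : {set V}) : nat := #|[set z in D | part (s z) != c]|.

Lemma nholes_gt0P s D :
  reflect (exists2 z, z \in D & part (s z) != c) (0 < nholes s D).
Proof.
apply: (iffP card_gt0P) => [[z]|[z zD hz]]; first by rewrite inE => /andP[]; exists z.
by exists z; rewrite inE zD.
Qed.

Lemma eq_nholes s s' D : {in D, s =1 s'} -> nholes s D = nholes s' D.
Proof.
move=> ess'; apply: eq_card => z; rewrite !inE.
by case zD: (z \in D) => //=; rewrite ess'.
Qed.

Lemma nholesC s D : nholes s D + nholes s (~: D) = nholes s setT.
Proof.
rewrite -[nholes s setT](cardsID D); congr (_ + _); apply: eq_card => z.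
  by rewrite !inE andbC.
by rewrite !inE.
Qed.

Lemma nholesT s : nholes s setT = #|[set u | part u != c]|.
Proof.
rewrite /nholes -(card_imset _ (@Defs.bij_inj _ _ s)); apply: eq_card => u; rewrite !inE.
apply/imsetP/idP => [[z zh ->]|hu]; first by rewrite !inE in zh.
by exists (bij_inv s u); rewrite ?inE bij_invK.
Qed.

(** The total number of holes is the same in every state, so the count in [D] is determined by the
    count in its complement. *)
Lemma nholes_outside s s' D :
  (forall y, y \notin D -> s' y = s y) -> nholes s' D = nholes s D.
Proof.
move=> out; apply: (@addIn (nholes s (~: D))).
rewrite nholesC -{1}(@eq_nholes s') ?nholesC ?nholesT // => z.
by rewrite inE => /out.
Qed.

Lemma bring_hole s v x z :
  z \in branch X v x -> part (s z) != c ->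
  exists s', [/\ reach s s', part (s' x) != c,
    forall y, y \notin branch X v x -> s' y = s y
    & nholes s' (branch X v x) = nholes s (branch X v x)].
Proof.
move=> zx hz; have [u w /= hu|s' [ss' s'x out]] := bring (pr := fun u => part u != c) _ zx hz.
  by rewrite negbK => /eqP->.
by exists s'; split=> //; apply: nholes_outside.
Qed.

Lemma notin_branch_root v x : X v x -> v \notin branch X v x.
Proof. by move=> Xvx; apply/negP => /(branch_neq Xvx)/eqP. Qed.

Lemma nbr_notin_branch v x y : X v x -> X v y -> x != y -> x \notin branch X v y.
Proof. by move=> Xvx Xvy nxy; apply: branch_notin (branch_root _ _ _). Qed.

(* The person of a third colour behind [b] is brought next to [b], and then
   passes the occupant of [b] inside the edge [b z1] so that it reaches [v]
   while [b] recovers its occupant. *)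
Lemma behind_exchangeable s v a b d z :
  X v a -> X v b -> X v d -> uniq [:: a; b; d] ->
  part (s a) = c -> part (s b) = c -> part (s v) != c ->
  part (s d) = part (s v) ->
  z \in branch X v a -> part (s z) != part (s v) -> part (s z) != c ->
  exch s (s a) (s b).
Proof.
move=> Xva Xvb Xvd uabd sac sbc svc sdv zva nzv nzc.
have nza : z != a by apply: contraNneq nzc => ->; apply/eqP.
have [z1 [Xaz1 nz1v zz1]] := branch_step treeX Xva zva nza.
pose pr u := (part u != part (s v)) && (part u != c).
have prP u w : pr u -> ~~ pr w -> part u != part w.
  by rewrite negb_and !negbK => /andP[n1 n2] /orP[]/eqP->.
have prz : pr (s z) by rewrite /pr nzv.
have [s1 [ss1 /andP[nz1 nz1c] out]] := bring prP zz1 prz.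
have sub := branch_sub treeX Xva Xaz1 nz1v.
have [nab nad nbd] : [/\ a != b, a != d & b != d].
  by move: uabd; rewrite /= !inE negb_or andbT => /andP[/andP[]].
have nva : v != a by apply: contraTneq Xva => <-; rewrite adj_irr.
have nvb : v != b by apply: contraTneq Xvb => <-; rewrite adj_irr.
have nvd : v != d by apply: contraTneq Xvd => <-; rewrite adj_irr.
have nbz : b \notin branch X a z1.
  by apply: contra (@nbr_notin_branch v b a _ _ _) => //; [apply: sub|rewrite eq_sym].
have ndz : d \notin branch X a z1.
  by apply: contra (@nbr_notin_branch v d a _ _ _) => //; [apply: sub|rewrite eq_sym].
have nvz : v \notin branch X a z1.
  by apply: contra (notin_branch_root Xva); apply: sub.
have naz := notin_branch_root Xaz1.
have neqz y : y \notin branch X a z1 -> y != z1.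
  by apply: contraNneq => ->; apply: branch_root.
have [s1v s1a s1b s1d] := And4 (out v nvz) (out a naz) (out b nbz) (out d ndz).
pose s2 := swap s1 a z1; pose s3 := swap s2 v a; pose s4 := swap s3 a z1.
have s2v : s2 v = s v by rewrite swapD ?neqz.
have s2a : s2 a = s1 z1 by rewrite swapL.
have s2z : s2 z1 = s a by rewrite swapR.
have s3v : s3 v = s1 z1 by rewrite swapL.
have s3a : s3 a = s v by rewrite swapR.
have s3z : s3 z1 = s a by rewrite swapD // eq_sym neqz.
have s4v : s4 v = s1 z1 by rewrite swapD ?neqz.
have s4a : s4 a = s a by rewrite swapL.
have s4b : s4 b = s b by rewrite !swapD ?neqz // eq_sym.
have s4d : s4 d = s d by rewrite !swapD ?neqz // eq_sym.
apply: (exchangeable_moved _ _ s4a s4b); first by rewrite sac.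
  apply: (connect_trans ss1); apply: connect_trans (connect_swap _ _) _.
  - exact: Xaz1.
  - by rewrite adjY s1a sac eq_sym.
  rewrite -/s2; apply: connect_trans (connect_swap Xva _) (connect_swap Xaz1 _).
  - by rewrite adjY s2v s2a eq_sym.
  by rewrite adjY s3a s3z sac.
(* The pair is back at [a] and [b], [v] holds the third part, and [d] still holds a person of the
   part of the former occupant of [v]. *)
apply: (star_exchangeable Xva Xvb Xvd uabd).
- by rewrite s4a s4b sac.
- by rewrite s4a s4v sac.
- by rewrite s4a s4d sac sdv.
by rewrite s4v s4d sdv.
Qed.

(** Holes of different parts allow the star exchange at once. Otherwise a person of a third part is
    either behind one of the pair, or in another branch [x] at [v], where it walks to [x] without
    disturbing [v], [a] and [b]. *)
Lemma spread_exchangeable s v a b d :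
  X v a -> X v b -> X v d -> uniq [:: a; b; d] ->
  part (s a) = c -> part (s b) = c -> part (s v) != c -> part (s d) != c ->
  exch s (s a) (s b).
Proof.
move=> Xva Xvb Xvd uabd sac sbc svc sdc.
have [edv|ndv] := eqVneq (part (s d)) (part (s v)); last first.
  by apply: (star_exchangeable Xva Xvb Xvd uabd); rewrite ?sac ?sbc // eq_sym.
have [u /andP[nuv nuc]] := third_part (part (s v)) c.
pose z := bij_inv s u; have su : s z = u by rewrite bij_invK.
have nzv : z != v by apply: contraNneq nuv => <-; rewrite su.
have [x Xvx zx] := branch_cover treeX nzv.
rewrite -su in nuv nuc.
have [exa|nxa] := eqVneq x a.
  by rewrite exa in zx; apply: (behind_exchangeable Xva Xvb Xvd uabd _ _ _ edv zx).
have [exb|nxb] := eqVneq x b.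
  rewrite exb in zx; apply: exchangeable_sym.
  apply: (@behind_exchangeable s v b a d z) => //.
  by move: uabd; rewrite /= !inE !negb_or eq_sym !andbT => /andP[/andP[-> ->] ->].
pose pr w := (part w != part (s v)) && (part w != c).
have prP w w' : pr w -> ~~ pr w' -> part w != part w'.
  by rewrite negb_and !negbK => /andP[n1 n2] /orP[]/eqP->.
have prz : pr (s z) by rewrite /pr nuv.
have [s1 [ss1 /andP[n1 n2] out]] := bring prP zx prz.
have nab : a != b by move: uabd; rewrite /= !inE negb_or => /andP[/andP[]].
have s1v : s1 v = s v by apply: out; apply: notin_branch_root.
have s1a : s1 a = s a by apply: out; apply: nbr_notin_branch => //; rewrite eq_sym.
have s1b : s1 b = s b by apply: out; apply: nbr_notin_branch => //; rewrite eq_sym.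
apply: (exchangeable_moved _ ss1 s1a s1b); first by rewrite sac.
apply: (star_exchangeable Xva Xvb Xvx); rewrite ?s1a ?s1b ?s1v ?sac // 1?eq_sym //.
by rewrite /= !inE negb_or nab eq_sym nxa eq_sym nxb.
Qed.

(** Bring a hole to each of [x] and [y], then let the person at [q] step to [x]. Now [q] and [y]
    hold holes, and the pair sits on the leaves [p] and [x] of a star at [q]. *)
Lemma two_branches_exchangeable s p q x y zx zy :
  X q p -> X q x -> X q y -> uniq [:: p; x; y] ->
  part (s p) = c -> part (s q) = c ->
  zx \in branch X q x -> part (s zx) != c ->
  zy \in branch X q y -> part (s zy) != c ->
  exch s (s p) (s q).
Proof.
move=> Xqp Xqx Xqy upxy spc sqc zxx hzx zyy hzy.
have [npx npy nxy] : [/\ p != x, p != y & x != y].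
  by move: upxy; rewrite /= !inE negb_or andbT => /andP[/andP[]].
have [s1 [ss1 s1x out1 _]] := bring_hole zxx hzx.
have s1zy : s1 zy = s zy.
  by apply: out1; apply: (branch_notin treeX Xqy Xqx); rewrite // eq_sym.
rewrite -s1zy in hzy; have [s2 [ss2 s2y out2 _]] := bring_hole zyy hzy.
have s2p : s2 p = s p by rewrite out2 ?out1 ?nbr_notin_branch.
have s2q : s2 q = s q by rewrite out2 ?out1 ?notin_branch_root.
have s2x : s2 x = s1 x by rewrite out2 ?nbr_notin_branch.
have neq z : X q z -> z != q by apply: contraTneq => ->; rewrite adj_irr.
pose s3 := swap s2 q x.
have s3p : s3 p = s p by rewrite swapD ?neq.
have s3x : s3 x = s q by rewrite swapR.
have s3q : s3 q = s1 x by rewrite swapL.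
have s3y : s3 y = s2 y by rewrite swapD ?neq // eq_sym.
have ss3 : reach s s3.
  apply: (connect_trans ss1); apply: (connect_trans ss2).
  by apply: connect_swap; rewrite // adjY s2q s2x sqc eq_sym.
apply: (exchangeable_moved _ ss3 s3p s3x); first by rewrite spc.
by apply: (spread_exchangeable Xqp Xqx Xqy); rewrite ?s3p ?s3x ?s3q ?s3y.
Qed.

Lemma nholes_swap s q x :
  X q x -> part (s q) = c -> part (s x) != c ->
  nholes s (branch X q x) = (nholes (swap s q x) (branch X q x)).+1.
Proof.
move=> Xqx sqc hx; rewrite /nholes (cardsD1 x) inE branch_root hx /=; congr _.+1.
apply: eq_card => z; rewrite !inE.
have [->|nzx] /= := eqVneq z x; first by rewrite swapR sqc eqxx andbF.
have [zx|//] /= := boolP (connect _ _ _).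
rewrite swapD //; apply: contraTneq zx => ->.
by have := notin_branch_root Xqx; rewrite inE.
Qed.

(* If all holes beyond [q] lie behind [x], then a third person at [y] is
   exchangeable with both persons. *)
Lemma branching_exchangeable s p q x y z0 zx :
  X q p -> X q x -> X q y -> uniq [:: p; x; y] ->
  part (s p) = c -> part (s q) = c ->
  z0 \in branch X q p -> part (s z0) != c ->
  zx \in branch X q x -> part (s zx) != c ->
  1 < nholes s (branch X p q) ->
  exch s (s p) (s q).
Proof.
move=> Xqp Xqx Xqy upxy spc sqc z0p hz0 zxx hzx h1.
have Xpq : X p q by rewrite (adj_sym X).
have [npx npy nxy] : [/\ p != x, p != y & x != y].
  by move: upxy; rewrite /= !inE negb_or andbT => /andP[/andP[]].
(* A hole beyond [q] but off the branch of [x] gives two branches with holes; so assume that there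
   is none. *)
have [/existsP[z /and3P[zpq nzx hz]]|noz] := boolP
    [exists z, [&& z \in branch X p q, z \notin branch X q x & part (s z) != c]].
  have nzq : z != q by apply: contraNneq hz => ->; apply/eqP.
  have [y' [Xqy' ny'p zy']] := branch_step treeX Xpq zpq nzq.
  have ny'x : y' != x by apply: contraNneq nzx => <-.
  apply: (two_branches_exchangeable Xqp Xqx Xqy' _ spc sqc zxx hzx zy' hz).
  by rewrite /= !inE negb_or npx eq_sym ny'p eq_sym ny'x.
have holex z : z \in branch X p q -> part (s z) != c -> z \in branch X q x.
  move=> zpq hz; apply: contraNT noz => nzx.
  by apply/existsP; exists z; rewrite zpq nzx.
have ypq : y \in branch X p q.
  by apply: (branch_sub treeX Xpq Xqy); rewrite ?branch_root // eq_sym.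
have syc : part (s y) = c.
  apply/eqP; apply: contraT => /(holex _ ypq).
  by rewrite (negbTE (nbr_notin_branch Xqy Xqx _)) // eq_sym.
(* Here the two branches with holes are those of [x] and [p]. By transitivity it then remains to
   exchange [s p] with [s y]. *)
have exyq : exch s (s y) (s q).
  apply: (two_branches_exchangeable Xqy Xqx Xqp _ syc sqc zxx hzx z0p hz0).
  by rewrite /= !inE negb_or ![_ == p]eq_sym ![y == _]eq_sym npx npy nxy.
apply: (exchangeable_trans (w := s y)); rewrite ?spc ?syc ?sqc // {exyq}.
have [s1 [ss1 s1x out1 nh1]] := bring_hole zxx hzx.
have s1q : s1 q = s q by rewrite out1 ?notin_branch_root.
have s1p : s1 p = s p by rewrite out1 ?nbr_notin_branch.
have s1y : s1 y = s y by rewrite out1 ?nbr_notin_branch // eq_sym.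
(* Of the at least two holes behind [x], one moves onto [q] and another is then brought to [x], as
   the star at [q] with leaves [p], [y], [x] requires. *)
have nh2 : 0 < nholes (swap s1 q x) (branch X q x).
  rewrite -ltnS -nholes_swap ?s1q // nh1; apply: (leq_trans h1).
  apply: subset_leq_card; apply/subsetP => z; rewrite !inE => /andP[zpq hz].
  by rewrite hz andbT; have := holex z; rewrite !inE; apply.
have /nholes_gt0P[z zqx hz] := nh2.
have [s3 [ss3 s3x out3 _]] := bring_hole zqx hz.
have neq z' : X q z' -> z' != q by apply: contraTneq => ->; rewrite adj_irr.
have s3q : s3 q = s1 x by rewrite out3 ?notin_branch_root // swapL.
have s3p : s3 p = s p by rewrite out3 ?nbr_notin_branch // swapD ?neq.
have s3y : s3 y = s y by rewrite out3 ?nbr_notin_branch ?swapD ?neq // eq_sym.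
have rs3 : reach s s3.
  apply: (connect_trans ss1); apply: connect_trans ss3.
  by apply: connect_swap; rewrite // adjY s1q sqc eq_sym.
apply: (exchangeable_moved _ rs3 s3p s3y); first by rewrite spc.
apply: (spread_exchangeable Xqp Xqy Xqx); rewrite ?s3p ?s3y ?s3q //.
by rewrite /= !inE negb_or [y == x]eq_sym npx npy nxy.
Qed.

(** One hole from beyond [q] passes through the pair and ends at [p], which shifts the pair by one
    edge. The price is one hole on the far side. *)
Lemma advance s p q (w : V) z :
  X q p -> X q w -> p != w -> part (s p) = c -> part (s q) = c ->
  z \in branch X q w -> part (s z) != c ->
  exists s', [/\ reach s s', s' q = s p, s' w = s q, part (s' p) != c
    & nholes s (branch X q w) = (nholes s' (branch X q w)).+1].
Proof.
move=> Xqp Xqw npw spc sqc zw hz.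
have Xpq : X p q by rewrite (adj_sym X).
have [s1 [ss1 s1w out1 nh1]] := bring_hole zw hz.
have s1q : s1 q = s q by rewrite out1 ?notin_branch_root.
have s1p : s1 p = s p by rewrite out1 ?nbr_notin_branch.
have neq y : X q y -> y != q by apply: contraTneq => ->; rewrite adj_irr.
have s2p : swap s1 q w p = s p by rewrite swapD ?neq.
exists (swap (swap s1 q w) p q); split.
- apply: (connect_trans ss1); apply: connect_trans (connect_swap Xqw _) (connect_swap Xpq _).
    by rewrite adjY s1q sqc eq_sym.
  by rewrite adjY s2p swapL spc eq_sym.
- by rewrite swapR s2p.
- by rewrite swapD ?neq 1?eq_sym // swapR.
- by rewrite swapL swapL.
rewrite -nh1 nholes_swap ?s1q //; congr _.+1; apply: eq_nholes => y yw.
rewrite [RHS]swapD //; apply: contraTneq yw => ->.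
  exact: nbr_notin_branch.
exact: notin_branch_root.
Qed.

(** * From failure of exchange to a bridge *)

Lemma degree_neq1 q p x : X q p -> X q x -> p != x -> degree X q != 1.
Proof.
move=> Xqp Xqx npx; rewrite neq_ltn; apply/orP; right.
by apply/card_gt1P; exists p, x; rewrite !inE.
Qed.

(** Induction on [N]: with two holes beyond [q], a third neighbour of [q] would allow the exchange,
    so [q] has degree 2. The pair then advances; this uses up one hole ahead and leaves one behind
    at [p], which restores the hypotheses for the next edge. *)
Lemma chain_of_nonexchangeable N s p q :
  X p q -> part (s p) = c -> part (s q) = c -> ~ exch s (s p) (s q) ->
  0 < nholes s (branch X q p) -> N < nholes s (branch X p q) ->
  exists l, [/\ size l = N, path X q l && uniq (q :: l),
    all (fun y => degree X y == 2) (belast q l), degree X (last q l) != 1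
    & {subset q :: l <= branch X p q}].
Proof.
elim: N s p q => [|N IHN] s p q Xpq spc sqc nex h0 hN;
  have Xqp : X q p by rewrite (adj_sym X).
all: have /nholes_gt0P[z zpq hz] : 0 < nholes s (branch X p q) by apply: leq_ltn_trans hN.
all: have nzq : z != q by apply: contraNneq hz => ->; apply/eqP.
all: have [x [Xqx nxp zx]] := branch_step treeX Xpq zpq nzq.
  (* In the base case one hole suffices: it is not at [q], so [q] has a neighbour besides [p]. *)
  exists [::]; split=> //=; first by apply: degree_neq1 Xqx Xqp nxp.
  by move=> w; rewrite inE => /eqP->; apply: branch_root.
have nbrs y : X q y -> y != p -> y = x.
  move=> Xqy nyp; apply/eqP; apply/negPn/negP => nyx; apply: nex.
  have /nholes_gt0P[z0 z0p hz0] := h0.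
  apply: (branching_exchangeable Xqp Xqx Xqy _ spc sqc z0p hz0 zx hz).
    by rewrite /= !inE negb_or eq_sym nxp eq_sym nyp eq_sym nyx.
  by apply: leq_trans hN.
have hx : N.+1 < nholes s (branch X q x).
  apply: (leq_trans hN); apply: subset_leq_card; apply/subsetP => y.
  rewrite in_set => /andP[ypq hy]; rewrite in_set hy andbT.
  have nyq : y != q by apply: contraNneq hy => ->; apply/eqP.
  have [x' [Xqx' nx'p yx']] := branch_step treeX Xpq ypq nyq.
  by rewrite -(nbrs x').
have npx : p != x by rewrite eq_sym.
have [s' [ss' s'q s'x s'p nh]] := advance Xqp Xqx npx spc sqc zx hz.
have Xxq : X x q by rewrite (adj_sym X).
case: (IHN s' q x Xqx); rewrite ?s'q ?s'x //.
- by move=> ex'; apply: nex; apply: exchangeable_reach ss' ex'; rewrite spc.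
- apply/nholes_gt0P; exists p => //.
  by apply: (branch_sub treeX Xxq Xqp npx); apply: branch_root.
- by rewrite -ltnS -nh.
move=> l [szl /andP[pathl uniql] degl lastl subl]; exists (x :: l); split=> //.
- by rewrite /= szl.
- rewrite /= Xqx pathl -[(x \notin l) && _]/(uniq (x :: l)) uniql !andbT /=.
  by apply: contra (notin_branch_root Xqx); apply: subl.
- rewrite /= degl andbT /degree; have -> : [set w | X q w] = [set p; x].
    apply/setP => y; rewrite !inE; apply/idP/orP => [Xqy|[]/eqP-> //].
    by have [->|nyp] := eqVneq y p; [left|right; rewrite (nbrs y)].
  by rewrite cards2 npx.
move=> y; rewrite inE => /orP[/eqP->|/subl]; first exact: branch_root.
exact: branch_sub.
Qed.

Lemma is_bridge_cons v l :
  l != [::] -> path X v l -> uniq (v :: l) ->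
  all (fun y => degree X y == 2) (behead (belast v l)) ->
  degree X v != 1 -> degree X (last v l) != 1 -> is_bridge X (v :: l).
Proof.
case: l => // x l _ pathl uniql degl degv degla; apply/and5P; split=> //.
by apply: sub_path pathl => a b; apply: tree_cut_edge.
Qed.

(** This serves the case of no hole on the side of [p], where the chain lemma cannot start. Absent
    an exchange, the holes beyond [q] all lie in one branch, so the pair advances once and leaves a
    hole behind it. *)
Lemma one_sided_exchangeable m s p q :
  1 < m -> ~ contains_bridge X m -> m <= nholes s (branch X p q) ->
  X p q -> part (s p) = c -> part (s q) = c -> exch s (s p) (s q).
Proof.
move=> m1 nbr hm Xpq spc sqc; have Xqp : X q p by rewrite (adj_sym X).
apply/negPn/negP => nex.
have em : m.-2.+2 = m by case: m m1 {nbr hm} => [|[]].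
have /nholes_gt0P[z zpq hz] : 0 < nholes s (branch X p q).
  by apply: leq_trans hm; apply: ltnW.
have nzq : z != q by apply: contraNneq hz => ->; apply/eqP.
have [x [Xqx nxp zx]] := branch_step treeX Xpq zpq nzq.
have npx : p != x by rewrite eq_sym.
have hx : m <= nholes s (branch X q x).
  apply: (leq_trans hm); apply: subset_leq_card; apply/subsetP => y.
  rewrite in_set => /andP[ypq hy]; rewrite in_set hy andbT.
  have nyq : y != q by apply: contraNneq hy => ->; apply/eqP.
  have [x' [Xqx' nx'p yx']] := branch_step treeX Xpq ypq nyq.
  have [<-//|nx'x] := eqVneq x' x; case/negP: nex.
  apply: (two_branches_exchangeable Xqp Xqx Xqx' _ spc sqc zx hz yx' hy).
  by rewrite /= !inE negb_or npx eq_sym nx'p eq_sym nx'x.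
have [s' [ss' s'q s'x s'p nh]] := advance Xqp Xqx npx spc sqc zx hz.
have Xxq : X x q by rewrite (adj_sym X).
(* At least [m - 1] holes remain ahead, so the chain [x :: l] has [m - 1] vertices. Adding [q]
   completes the bridge; as an end vertex, [q] only needs degree other than 1. *)
have [] := @chain_of_nonexchangeable m.-2 s' q x Xqx; rewrite ?s'q ?s'x //.
- by move=> ex'; case/negP: nex; apply: exchangeable_reach ss' ex'; rewrite spc.
- apply/nholes_gt0P; exists p => //.
  by apply: (branch_sub treeX Xxq Xqp npx); apply: branch_root.
- by rewrite -ltnS -nh; apply: leq_trans hx; rewrite em.
move=> l [szl /andP[pathl uniql] degl lastl subl]; apply: nbr.
exists [:: q, x & l]; first by rewrite /= szl.
apply: is_bridge_cons => //; first by rewrite /= Xqx.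
  rewrite cons_uniq uniql andbT.
  by apply: contra (notin_branch_root Xqx); apply: subl.
exact: degree_neq1 Xqp Xqx npx.
Qed.

Lemma same_part_exchangeable m s p q :
  1 < m -> ~ contains_bridge X m -> m <= #|[set u | part u != c]| ->
  X p q -> part (s p) = c -> part (s q) = c -> exch s (s p) (s q).
Proof.
move=> m1 nbr hm Xpq spc sqc; have Xqp : X q p by rewrite (adj_sym X).
have opp : ~: branch X p q = branch X q p.
  apply/setP => z; rewrite in_setC; apply/idP/idP => [nz|zqp].
    by have := branch_total treeX z Xpq; rewrite (negbTE nz).
  by apply/negP => zpq; apply: (branch_opp treeX Xpq zpq zqp).
have hpq : m <= nholes s (branch X p q) + nholes s (branch X q p).
  by rewrite -opp nholesC nholesT.
case: (posnP (nholes s (branch X q p))) => [q0|qpos].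
  by apply: one_sided_exchangeable nbr _ Xpq spc sqc => //; rewrite q0 addn0 in hpq.
case: (posnP (nholes s (branch X p q))) => [p0|ppos].
  by apply/exchangeable_sym/(one_sided_exchangeable m1 nbr _ Xqp); rewrite ?p0 in hpq *.
apply/negPn/negP => nex.
(* The chains will have [N + 1] and [N' + 1] vertices, hence the 2. The first is taken as long as
   its holes and [m] permit, and the second makes up the rest. *)
have [N [N' [hN hN' eN]]] : exists N N', [/\ N < nholes s (branch X p q),
    N' < nholes s (branch X q p) & N + N' + 2 = m].
  move: (nholes s (branch X p q)) (nholes s (branch X q p)) m1 hpq qpos ppos.
  move=> h h' m1 hh h0 h0'; clear -m1 hh h0 h0'.
  by exists (minn h.-1 m.-2), (m.-2 - minn h.-1 m.-2); split; lia.
have [l1 [sz1 /andP[path1 uniq1] deg1 last1 sub1]] :=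
  chain_of_nonexchangeable Xpq spc sqc (negP nex) qpos hN.
have nex' : ~ exch s (s q) (s p) by move=> /exchangeable_sym; apply/negP.
have [l2 [sz2 /andP[path2 uniq2] deg2 last2 sub2]] :=
  chain_of_nonexchangeable Xqp sqc spc nex' ppos hN'.
(* This is [rev (p :: l2) ++ q :: l1] with its head exposed, the form that [is_bridge] inspects. *)
apply: nbr; exists (last p l2 :: rev (belast p l2) ++ q :: l1).
  by rewrite /= size_cat size_rev size_belast /= sz1 sz2 -eN addnS addn2 addnC.
have last_rev : last (last p l2) (rev (belast p l2)) = p.
  by case: (l2) => //= y l; rewrite rev_cons last_rcons.
have rev_eq : last p l2 :: rev (belast p l2) = rev (p :: l2) by rewrite [p :: l2]lastI rev_rcons.
apply: is_bridge_cons => //.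
- by case: (rev _).
- rewrite cat_path /= last_rev Xpq path1 !andbT rev_path.
  by apply: sub_path path2 => a b; rewrite (adj_sym X).
- rewrite -cat_cons rev_eq cat_uniq rev_uniq uniq2 uniq1 andbT andTb.
  apply/hasPn => y /sub1 ypq; rewrite mem_rev; apply/negP => /sub2 yqp.
  exact: branch_opp ypq yqp.
(* The interior is [rev (belast p l2) ++ belast q l1], where both chains have degree 2. *)
- rewrite belast_cat last_rev /= -cat_rcons -[p in rcons _ p]last_rev -lastI /=.
  by rewrite all_cat all_rev deg2.
by rewrite last_cat /=.
Qed.

End Exchange.
End Multipartite.

(** * Sizes of the parts and conclusion *)

Lemma last_lt_sumn (s : seq nat) : 2 < size s -> all (leq 1) s -> (last 0 s).+1 < sumn s.
Proof.
case/lastP: s => // s z; rewrite last_rcons sumn_rcons size_rcons all_rcons.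
case: s => [|a [|b s]] //= _ /and4P[_ a1 b1 _]; rewrite addnA -[z.+2]add2n leq_add2r.
by apply: leq_trans (leq_addr _ _); apply: (leq_add a1 b1).
Qed.

Lemma tnth_le_last (t : nat) (k : t.-tuple nat) (c : 'I_t) :
  sorted leq k -> tnth k c <= last 0 k.
Proof.
move=> sk; rewrite (tnth_nth 0) -nth_last size_tuple.
have t0 : 0 < t by apply: leq_trans (ltn_ord c).
apply: (sorted_leq_nth leq_trans leqnn) => //; rewrite ?inE ?size_tuple ?prednK //.
by rewrite -ltnS prednK.
Qed.

Theorem theorem5p1 (t : nat) (k : t.-tuple nat) (n : nat)
    (V : finType) (X : sgraph V) (Y : sgraph 'I_n) :
  2 < t ->
  path leq 1 k ->
  n = sumn k ->
  4 <= n ->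
  is_complete_multipartite k Y ->
  #|V| = n ->
  is_tree X ->
  ~ contains_bridge X (n - last 0 k) ->
  forall (i j : 'I_n) (s : bij V 'I_n),
    X (bij_inv s i) (bij_inv s j) ->
    exchangeable X Y s i j.
Proof.
move=> t2 pathk nk _ [part cardpart adjY] _ treeX nbr i j s Xij.
have kpos : all (leq 1) k by apply: order_path_min pathk; apply: leq_trans.
rewrite -(bij_invK s i) -(bij_invK s j).
have [epart|npart] := eqVneq (part i) (part j); last first.
  by apply: connect_swap; rewrite // adjY !bij_invK.
have third (d e : 'I_t) : exists u, (part u != d) && (part u != e).
  have /existsP[f /andP[nfd nfe]] : [exists f : 'I_t, (f != d) && (f != e)].
    apply: contraLR t2 => /existsPn none; rewrite -leqNgt -[t]card_ord.
    apply: leq_trans (subset_leq_card _) (_ : #|[set d; e]| <= 2).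
      by apply/subsetP => f _; rewrite !inE; have := none f; rewrite negb_and !negbK.
    by rewrite cards2; case: (_ != _).
  have /card_gt0P[u] : 0 < #|[set v | part v == f]|.
    by rewrite cardpart; apply: (allP kpos); apply: mem_tnth.
  by rewrite inE => /eqP euf; exists u; rewrite euf nfd.
apply: (same_part_exchangeable adjY treeX third (c := part i) _ nbr _ Xij).
(* At least two parts besides the last are nonempty, so the bridge length is at least 2 and the
   separate case of a single cut-vertex does not arise. *)
- by rewrite nk ltn_subRL addn1 last_lt_sumn // size_tuple.
(* The holes number [n] minus the size of the part of [i], and the last part is a largest one. *)
- have -> : [set u | part u != part i] = ~: [set u | part u == part i].
    by apply/setP => u; rewrite !inE.
  rewrite -[n in n - _]card_ord -(cardsC [set u | part u == part i]) cardpart.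
  by rewrite leq_subLR leq_add2r tnth_le_last // (path_sorted pathk).
- by rewrite bij_invK.
by rewrite bij_invK.
Qed.
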